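(* Let $X$ and $Y$ be non-negative continuous random variables, let $\eta>0$, and let $\varPsi$ be a function for which the transformed variables $\varPsi(X)$, $\varPsi(Y)$ are considered. (1) If $X\leq_{RHQ}Y$ and $\varPsi$ is increasing and concave, then $X\leq_{disp}Y$ implies $\varPsi(X)\geq_{QFGCPE}\varPsi(Y)$. (2) If $X\leq_{HQ}Y$ and $\varPsi$ is increasing and convex, then $X\leq_{disp}Y$ implies $\varPsi(X)\leq_{QFGCPE}\varPsi(Y)$.
   Context: Random variables (including $\varPsi(X),\varPsi(Y)$) are non-negative and absolutely continuous; $\varPsi$ is differentiable with derivative $\varPsi'$. For a random variable $X$ with distribution function $G_X$ and density $g_X$, the quantile function is $Q_X(v)=\inf\{x: G_X(x)\ge v\}$, $0\le v\le 1$, and the quantile density function is $q_X(v)=\frac{d}{dv}Q_X(v)$; it satisfies $q_X(v)\,g_X(Q_X(v))=1$. For $\eta>0$ the quantile-based fractional generalized cumulative past entropy (QFGCPE) of $X$ is $$\mathcal{C}\mathcal{P}\xi_Q^\eta(X)=\frac{1}{\Gamma(\eta+1)}\int_0^1 p(-\ln p)^\eta q_X(p)\,dp$$ (integral assumed finite). The hazard quantile function is $H_X(v)=[(1-v)q_X(v)]^{-1}$ and the reversed hazard quantile function is $R_X(v)=[v\,q_X(v)]^{-1}$, for $v\in(0,1)$. Orders: $X\leq_{HQ}Y$ means $H_X(v)\ge H_Y(v)$ for all $v\in(0,1)$; $X\leq_{RHQ}Y$ means $R_X(v)\le R_Y(v)$ for all $v\in(0,1)$; $X\leq_{disp}Y$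 is used here in the paper's own quantile form, meaning $Q_Y(v)-Q_X(v)\ge 0$ for all $v\in(0,1)$; $X\leq_{QFGCPE}Y$ means $\mathcal{C}\mathcal{P}\xi_Q^\eta(X)\le \mathcal{C}\mathcal{P}\xi_Q^\eta(Y)$, and $X\geq_{QFGCPE}Y$ means $Y\leq_{QFGCPE}X$. *)

(* Defs.v *)
From HB Require Import structures.
From mathcomp Require Import all_boot all_order all_algebra.
From mathcomp Require Import all_classical all_reals all_analysis.

Set Implicit Arguments.
Unset Strict Implicit.
Unset Printing Implicit Defensive.
Import Order.TTheory GRing.Theory Num.Theory.
Import numFieldNormedType.Exports.

Local Open Scope classical_set_scope.
Local Open Scope ring_scope.

(* Euler's Gamma function, for a > 0. *)
Definition Gamma (R : realType) (a : R) : R :=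
  \int[lebesgue_measure]_(t in `]0, +oo[) (t `^ (a - 1) * expR (- t)).

Section quantile_functions.
Context (d : measure_display) (T : measurableType d) (R : realType).
Variable P : probability T R.
Implicit Types (X : {RV P >-> R}) (g : R -> R) (v eta : R).

Definition rv_map (Psi : {mfun R >-> R}) X : {RV P >-> R} := Psi \o X.

Definition ae_nonneg X : Prop := {ae P, forall t, 0 <= X t}.

Definition abs_continuous X : Prop := distribution P X `<< lebesgue_measure.

Definition is_density X g : Prop :=
  [/\ measurable_fun setT g, forall x, 0 <= g x &
      forall A, measurable A ->
        distribution P X A = (\int[lebesgue_measure]_(x in A) (g x)%:E)%E].

(* Only the values at 0 < v < 1 are meaningful: there the set is nonempty and
   bounded below; outside that range inf may take its default value 0. *)
Definition quantile X v : R := inf [set x | (v%:E <= cdf X x)%E].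

Definition quantile_density X : R -> R := derive1 (quantile X).

(* The quantile density exists on all of ]0, 1[ and is linked to some version
   g of the density by q(v) g(Q(v)) = 1; in particular q(v) is not 0, so the
   inverses below are genuine inverses. *)
Definition has_quantile_density X : Prop :=
  {in `]0, 1[, forall v, derivable (quantile X) v 1} /\
  exists2 g, is_density X g &
    {in `]0, 1[, forall v, quantile_density X v * g (quantile X v) = 1}.

Definition hazard_quantile X v : R := ((1 - v) * quantile_density X v)^-1.

Definition rev_hazard_quantile X v : R := (v * quantile_density X v)^-1.

Definition qfgcpe_integrand eta X (p : R) : R :=
  p * (- ln p) `^ eta * quantile_density X p.

Definition qfgcpe_finite eta X : Prop :=
  lebesgue_measure.-integrable `[0, 1] (EFin \o qfgcpe_integrand eta X).

Definition qfgcpe eta X : R :=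
  (Gamma (eta + 1))^-1 *
  \int[lebesgue_measure]_(p in `[0, 1]) qfgcpe_integrand eta X p.

End quantile_functions.

(* The two variables being compared may live on different probability
   spaces. *)
Section quantile_orders.
Context (d1 d2 : measure_display) (T1 : measurableType d1)
  (T2 : measurableType d2) (R : realType).
Variables (P1 : probability T1 R) (P2 : probability T2 R).
Implicit Types (X : {RV P1 >-> R}) (Y : {RV P2 >-> R}).

Definition le_HQ X Y : Prop :=
  {in `]0, 1[, forall v : R, hazard_quantile Y v <= hazard_quantile X v}.

Definition le_RHQ X Y : Prop :=
  {in `]0, 1[,
    forall v : R, rev_hazard_quantile X v <= rev_hazard_quantile Y v}.

(* Not the usual dispersive order: this compares the quantiles themselves
   rather than their increments. *)
Definition le_disp X Y : Prop :=
  {in `]0, 1[, forall v : R, 0 <= quantile Y v - quantile X v}.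

Definition le_QFGCPE (eta : R) X Y : Prop := qfgcpe eta X <= qfgcpe eta Y.

End quantile_orders.

(* Shape conditions are imposed on the open half-line only: an absolutely
   continuous non-negative random variable is almost surely positive. *)
Section half_line.
Context (R : realType).
Implicit Type Psi : R -> R.

Definition differentiable_pos Psi : Prop :=
  {in `]0, +oo[, forall x, derivable Psi x 1}.

Definition increasing_pos Psi : Prop :=
  {in `]0, +oo[ &, {homo Psi : x y / x <= y}}.

Definition convex_pos Psi : Prop :=
  convex_function (`]0, +oo[%classic : set R) (Psi : R -> R^o).

Definition concave_pos Psi : Prop :=
  convex_function (`]0, +oo[%classic : set R) ((fun x => - Psi x) : R -> R^o).

End half_line.

(* Main.v *)
Require Import Defs.
From HB Require Import structures.
From mathcomp Require Import all_boot all_order all_algebra.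
From mathcomp Require Import all_classical all_reals all_analysis.
From mathcomp Require Import lra.
Set Implicit Arguments.
Unset Strict Implicit.
Unset Printing Implicit Defensive.
Import Order.TTheory GRing.Theory Num.Theory.
Import numFieldNormedType.Exports.
Local Open Scope classical_set_scope.
Local Open Scope ring_scope.

(** Only the quantile densities matter: the entropy integrates [q] against the
    weight [p (- ln p)^eta], which is nonnegative on [0, 1], so an inequality
    between two quantile densities on ]0, 1[ passes to the entropies
    ([le_qfgcpe]).

    A nondecreasing transformation acts on quantiles by composition,
    [Q_{Psi(X)} = Psi o Q_X] on ]0, 1[ ([quantile_rv_map]), so the chain rule
    gives [q_{Psi(X)} = Psi'(Q_X) q_X] ([quantile_density_rv_map]).  Both
    factors are nonnegative, so they can be compared separately.  Either
    hazard order is an inequality between [q_X] and [q_Y], since the factor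
    [1 - v] (or [v]) cancels.  As [Q_X <= Q_Y], the factors [Psi'(Q_X)] and
    [Psi'(Q_Y)] compare by monotonicity of [Psi']: it is nondecreasing when
    [Psi] is convex and nonincreasing when [Psi] is concave
    ([convex_derive1_homo]).  In each of the two cases both comparisons point in
    the same direction.

    The composition rule rests on the Galois connection
    [Q(v) <= x <-> v <= F(x)] ([quantile_le]), which holds because [F] is right
    continuous.  The shape of [Psi] is known on the positive half-line only;
    this is harmless because the variables are almost surely positive
    ([cdf0_eq0]), hence have positive quantiles. *)

(** * One-sided bounds on derivatives *)

Section derivative_bounds.
Context (R : realType).
Implicit Types (f : R -> R) (D : set R).

(** The right-hand difference quotients of [h |-> f (h * v + x)] at 0 tend to
    [v * f' x].  Allowing any sign of [v] lets a single statement give upper and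
    lower bounds on [f' x]. *)
Lemma derive1_le_chord f (x v c : R) : derivable f x 1 ->
  (\forall h \near 0^'+, f (h * v + x) - f x <= h * c) ->
  v * f^`()%classic x <= c.
Proof.
move=> fx Hc.
have df : differentiable f x by exact/derivable1_diffP.
have fv : derivable f x v by exact: diff_derivable.
have -> : v * f^`()%classic x = 'D_v f x by rewrite deriveE// deriv1E.
have /cvg_dnbhs_at_right fvr : h^-1 *: (f (h *: v + x) - f x) @[h --> 0^'] -->
  'D_v f x by exact: fv.
rewrite -(cvg_lim _ fvr)//; apply: limr_le.
  by apply/cvg_ex; exists ('D_v f x).
near=> h; have h0 : 0 < h by near: h; exact: nbhs_right_gt.
suff : h^-1 * (f (h * v + x) - f x) <= c by [].
rewrite ler_pdivrMl//.
by near: h.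
Unshelve. all: by end_near. Qed.

(** A backward step [v = -1] turns monotonicity into a one-sided upper bound
    on [- f' x]. *)
Lemma ndecr_derive1_ge0 f (a x : R) : a < x -> derivable f x 1 ->
  {in `]a, +oo[ &, {homo f : y z / y <= z}} -> 0 <= f^`()%classic x.
Proof.
move=> ax fx f_nd.
suff : -1 * f^`()%classic x <= 0 by rewrite mulN1r oppr_le0.
apply: derive1_le_chord => //; near=> h.
have h0 : 0 < h by near: h; exact: nbhs_right_gt.
have hx : h < x - a by near: h; apply: nbhs_right_lt; rewrite subr_gt0.
by rewrite mulr0 subr_le0; apply: f_nd; rewrite ?in_itv/= ?andbT; lra.
Unshelve. all: by end_near. Qed.

(** Convexity bounds the increment of [f] over a step [h (y - x)] by
    [h (f y - f x)]; dividing by [h] and letting [h] tend to 0 gives the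
    tangent inequality, whichever side of [x] the point [y] lies on. *)
Lemma convex_above_tangent D f (x y : R) : convex_function D (f : R -> R^o) ->
  x \in D -> y \in D -> derivable f x 1 ->
  (y - x) * f^`()%classic x <= f y - f x.
Proof.
move=> cf Dx Dy fx; apply: derive1_le_chord => //; near=> h.
have h0 : 0 <= h by apply/ltW; near: h; exact: nbhs_right_gt.
have h1 : h <= 1 by apply/ltW; near: h; exact: nbhs_right_lt.
have := cf (Itv.mk (itv01_subdef h0 h1)) y x Dy Dx.
rewrite !convRE /= /unstable.onem.
have -> : h * (y - x) + x = h * y + (1 - h) * x by lra.
lra.
Unshelve. all: by end_near. Qed.

(** Adding the tangent inequalities at [x] and at [y] leaves
    [(y - x) (f' x - f' y) <= 0]. *)
Lemma convex_derive1_homo D f (x y : R) : convex_function D (f : R -> R^o) ->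
  x \in D -> y \in D -> derivable f x 1 -> derivable f y 1 ->
  x <= y -> f^`()%classic x <= f^`()%classic y.
Proof.
move=> cf Dx Dy fx fy; rewrite le_eqVlt => /predU1P[->//|xy].
have := convex_above_tangent cf Dx Dy fx.
have := convex_above_tangent cf Dy Dx fy.
by move=> ty tx; rewrite -(ler_pM2l (x := y - x)) ?subr_gt0//; lra.
Qed.

End derivative_bounds.

(** * Quantiles and quantile densities *)

Section quantile_theory.
Context (d : measure_display) (T : measurableType d) (R : realType)
  (P : probability T R).
Implicit Types (X : {RV P >-> R}) (x v : R).

(** The limits of the distribution function, 1 at [+oo] and 0 at [-oo], keep
    the infimum defining the quantile away from its default value. *)
Lemma has_inf_cdf_ge X v : 0 < v < 1 -> has_inf [set x | (v%:E <= cdf X x)%E].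
Proof.
move=> /andP[v0 v1]; split.
- have [M [_ FM]] : \forall x \near +oo, (v%:E < cdf X x)%E.
    have F1 : (v%:E < 1)%E by rewrite lte_fin.
    exact: (cvg_cdfy1 X (open_ereal_gt' F1)).
  by exists (M + 1); apply/ltW/FM; rewrite ltrDl.
- have [M [_ FM]] : \forall x \near -oo, (cdf X x < v%:E)%E.
    have F0 : (0 < v%:E)%E by rewrite lte_fin.
    exact: (cvg_cdfNy0 X (open_ereal_lt' F0)).
  by exists M => x /= Fx; rewrite leNgt; apply/negP => /FM; rewrite ltNge Fx.
Qed.

(** Right continuity makes the infimum attained: [F >= v] on the right of
    [Q(v)], hence at [Q(v)] itself. *)
Lemma quantile_le X v x : 0 < v < 1 ->
  (quantile X v <= x) = (v%:E <= cdf X x)%E.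
Proof.
move=> v01; have hi := has_inf_cdf_ge X v01.
apply/idP/idP => [Qx|Fx]; last exact: (ge_inf hi.2).
apply: (le_trans _ (cdf_nondecreasing X Qx)).
apply: (cvge_ge _ (@cdf_right_continuous _ _ _ _ X (quantile X v))).
near=> y; have Qy : quantile X v < y by near: y; exact: nbhs_right_gt.
have [z /= vz /ltW zy] := inf_lt hi.1 Qy.
exact: le_trans vz (cdf_nondecreasing X zy).
Unshelve. all: by end_near. Qed.

(** The Galois connection characterizes the quantile, so a quantile can be
    computed without handling the infimum. *)
Lemma quantile_unique X v q :
  (forall x, (v%:E <= cdf X x)%E = (q <= x)) -> quantile X v = q.
Proof.
move=> H; rewrite /quantile.
rewrite (_ : [set _ | _] = [set` `[q, +oo[]) ?inf_itv//.
by apply/seteqP; split => x /=; rewrite H in_itv/= andbT.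
Qed.

(** Absolute continuity excludes an atom at 0, so that a nonnegative variable
    is almost surely positive. *)
Lemma cdf0_eq0 X : ae_nonneg X -> abs_continuous X -> cdf X 0 = 0%E.
Proof.
move=> X0 Xac; apply/eqP; rewrite eq_le cdf_ge0 andbT /cdf.
rewrite -(setUitv1 (a := -oo%O) (x := 0 : R) true)//.
apply: (le_trans (measureU2 _ _ _)) => //.
have neg0 : distribution P X `]-oo, 0[ = 0%E.
  apply: (measure_negligible (mu := P)); first exact: measurable_funPTI.
  by apply: negligibleS X0 => t /=; rewrite in_itv/= leNgt => ->.
have zero0 : distribution P X [set 0] = 0%E.
  apply/measure0_null_setP => //; apply: Xac; apply/measure0_null_setP => //.
  exact: lebesgue_measure_set1.
by rewrite [X in (X + _)%E]neg0 [X in (_ + X)%E]zero0 adde0.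
Qed.

Lemma quantile_gt0 X v : ae_nonneg X -> abs_continuous X -> 0 < v < 1 ->
  0 < quantile X v.
Proof.
move=> X0 Xac v01; rewrite ltNge quantile_le// cdf0_eq0// -ltNge.
by rewrite lte_fin; case/andP: v01.
Qed.

Lemma quantile_density_gt0 X v : has_quantile_density X -> v \in `]0, 1[ ->
  0 < quantile_density X v.
Proof.
move=> [_ [g [_ g0 _] qg1]] /qg1 qg.
have : 0 < quantile_density X v * g (quantile X v) by rewrite qg.
by apply: contraPT; rewrite -leNgt => q0;
  apply/negP; rewrite -leNgt mulr_le0_ge0.
Qed.

(** By [quantile_unique] it suffices that [v <= F_{Psi(X)}(y)] amounts to
    [Psi (Q_X v) <= y].  If [Psi (Q_X v) <= y], monotonicity puts [X <= Q_X v]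
    inside [Psi X <= y] up to the null event [X <= 0].  If
    [y < Psi (Q_X v)], continuity provides a point [x] with [0 < x < Q_X v] and
    [y < Psi x]; then [Psi X <= y] forces [X <= x], an event of probability
    less than [v]. *)
Lemma quantile_rv_map X (Psi : {mfun R >-> R}) v :
  ae_nonneg X -> abs_continuous X -> differentiable_pos Psi ->
  increasing_pos Psi -> 0 < v < 1 ->
  quantile (rv_map Psi X) v = Psi (quantile X v).
Proof.
move=> X0 Xac dPsi iPsi v01; apply: quantile_unique => y.
have Q0 := quantile_gt0 X0 Xac v01.
have in_pos z : 0 < z -> z \in `]0, +oo[ by rewrite in_itv/= andbT.
apply/idP/idP => [|Psiy]; last first.
  have : (v%:E <= cdf X (quantile X v))%E by rewrite -quantile_le.
  move=> /le_trans; apply.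
  rewrite -[leRHS]adde0 -(cdf0_eq0 X0 Xac).
  have mPsiX : measurable (rv_map Psi X @^-1` `]-oo, y]).
    exact: measurable_funPTI.
  have mX0 : measurable (X @^-1` `]-oo, 0]) by exact: measurable_funPTI.
  apply: (le_trans _ (measureU2 P mPsiX mX0)).
  rewrite /cdf /distribution /pushforward.
  apply: (le_measure P); rewrite ?inE; [exact: measurable_funPTI| |].
    exact: measurableU.
  (* The event X <= 0 absorbs the points where Psi is uncontrolled. *)
  move=> t /=; rewrite !in_itv/= => XQ.
  have [Xt|Xt] := leP (X t) 0; [by right|left].
  by apply: le_trans Psiy; apply: iPsi; rewrite ?in_pos.
apply: contraTT; rewrite -!ltNge => yPsi.
have Psi_cont : {for quantile X v, continuous Psi}.
  by apply/differentiable_continuous/derivable1_diffP/dPsi/in_pos.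
have [x /andP[x0 xQ] yx] : exists2 x, 0 < x < quantile X v & y < Psi x.
  have yPsi_near : \forall x \near (quantile X v)^'-, y < Psi x.
    exact: (cvgr_gt _ (cvg_at_left_filter Psi_cont)).
  near (quantile X v)^'- => x; exists x; last by near: x.
  apply/andP; split; near: x; [exact: nbhs_left_gt|exact: nbhs_left_lt].
apply: (@le_lt_trans _ _ (cdf X x)); last first.
  by rewrite ltNge -quantile_le// -ltNge.
rewrite /cdf /distribution /pushforward.
apply: (le_measure P); rewrite ?inE; [exact: measurable_funPTI..|].
move=> t /=; rewrite !in_itv/= => Psit; rewrite leNgt; apply/negP => xXt.
have : Psi x <= Psi (X t).
  by apply: iPsi; rewrite ?in_pos ?(ltW xXt)// (lt_trans x0).
by rewrite leNgt (le_lt_trans Psit yx).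
Unshelve. all: by end_near. Qed.

Lemma quantile_density_rv_map X (Psi : {mfun R >-> R}) v :
  ae_nonneg X -> abs_continuous X -> has_quantile_density X ->
  differentiable_pos Psi -> increasing_pos Psi -> v \in `]0, 1[ ->
  quantile_density (rv_map Psi X) v =
  Psi^`()%classic (quantile X v) * quantile_density X v.
Proof.
move=> X0 Xac [dQ _] dPsi iPsi v01.
have Q0 : 0 < quantile X v.
  by apply: quantile_gt0 => //; move: v01; rewrite in_itv.
rewrite /quantile_density -derive1_comp; [|exact: dQ|].
  rewrite !derive1E; apply: near_eq_derive; near=> w.
  apply: quantile_rv_map => //.
  suff : w \in `]0, 1[ by rewrite in_itv.
  by near: w; exact: near_in_itvoo.
by apply: dPsi; rewrite in_itv/= andbT.
Unshelve. all: by end_near. Qed.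

End quantile_theory.

(** * Comparison of entropies *)

Lemma Gamma_ge0 (R : realType) (a : R) : 0 <= Gamma a.
Proof.
by apply: Rintegral_ge0 => t _; rewrite mulr_ge0 ?powR_ge0 ?expR_ge0.
Qed.

(** At both endpoints the weight [p (- ln p)^eta] vanishes (at 1 because
    [eta > 0]), so a comparison on the open interval is enough. *)
Lemma le_qfgcpe (R : realType) (d1 d2 : measure_display)
    (T1 : measurableType d1) (T2 : measurableType d2)
    (P1 : probability T1 R) (P2 : probability T2 R)
    (X : {RV P1 >-> R}) (Y : {RV P2 >-> R}) (eta : R) :
  0 < eta -> qfgcpe_finite eta X -> qfgcpe_finite eta Y ->
  {in `]0, 1[, forall v, quantile_density X v <= quantile_density Y v} ->
  le_QFGCPE eta X Y.
Proof.
move=> eta0 Xfin Yfin qXY.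
rewrite /le_QFGCPE /qfgcpe ler_wpM2l ?invr_ge0 ?Gamma_ge0//.
apply: le_Rintegral => // v /=; rewrite in_itv/= => /andP[v0 v1].
rewrite /qfgcpe_integrand.
have [->|vn0] := eqVneq v 0; first by rewrite !mul0r.
have [->|vn1] := eqVneq v 1.
  by rewrite ln1 oppr0 powR0 ?gt_eqF// mulr0 !mul0r.
rewrite ler_wpM2l ?mulr_ge0 ?powR_ge0// qXY// in_itv/=.
by rewrite !lt_neqAle v0 v1 vn1 eq_sym vn0.
Qed.

Theorem theorem2p3 (R : realType) (d1 d2 : measure_display)
    (T1 : measurableType d1) (T2 : measurableType d2)
    (P1 : probability T1 R) (P2 : probability T2 R)
    (X : {RV P1 >-> R}) (Y : {RV P2 >-> R}) (Psi : {mfun R >-> R})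
    (eta : R) (eta_gt0 : 0 < eta)
    (X_ge0 : ae_nonneg X) (Y_ge0 : ae_nonneg Y)
    (PsiX_ge0 : ae_nonneg (rv_map Psi X))
    (PsiY_ge0 : ae_nonneg (rv_map Psi Y))
    (X_ac : abs_continuous X) (Y_ac : abs_continuous Y)
    (PsiX_ac : abs_continuous (rv_map Psi X))
    (PsiY_ac : abs_continuous (rv_map Psi Y))
    (X_qd : has_quantile_density X) (Y_qd : has_quantile_density Y)
    (Psi_diff : differentiable_pos Psi)
    (PsiX_fin : qfgcpe_finite eta (rv_map Psi X))
    (PsiY_fin : qfgcpe_finite eta (rv_map Psi Y)) :
  (le_RHQ X Y -> increasing_pos Psi -> concave_pos Psi ->
     le_disp X Y -> le_QFGCPE eta (rv_map Psi Y) (rv_map Psi X)) /\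
  (le_HQ X Y -> increasing_pos Psi -> convex_pos Psi ->
     le_disp X Y -> le_QFGCPE eta (rv_map Psi X) (rv_map Psi Y)).
Proof.
split=> [RHQ|HQ] iPsi cPsi QXY; apply: le_qfgcpe => // v v01.
all: rewrite !quantile_density_rv_map//.
all: have qX0 := quantile_density_gt0 X_qd v01.
all: have qY0 := quantile_density_gt0 Y_qd v01.
all: have /andP[v0 v1] : 0 < v < 1 by move: v01; rewrite in_itv.
all: have QX0 : 0 < quantile X v by rewrite quantile_gt0 ?v0.
all: have QY0 : 0 < quantile Y v by rewrite quantile_gt0 ?v0.
all: have dX : derivable Psi (quantile X v) 1
  by apply: Psi_diff; rewrite in_itv/= andbT.
all: have dY : derivable Psi (quantile Y v) 1
  by apply: Psi_diff; rewrite in_itv/= andbT.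
all: apply: ler_pM.
all: rewrite ?(ltW qX0) ?(ltW qY0) ?(ndecr_derive1_ge0 QX0)
  ?(ndecr_derive1_ge0 QY0)//.
- rewrite -lerN2 -!derive1N//.
  apply: (convex_derive1_homo cPsi); rewrite ?inE/= ?in_itv/= ?andbT//.
  + exact: derivableN.
  + exact: derivableN.
  + by rewrite -subr_ge0 QXY.
- have := RHQ _ v01; rewrite /rev_hazard_quantile.
  by rewrite lef_pV2 ?posrE ?mulr_gt0// ler_pM2l.
- apply: (convex_derive1_homo cPsi); rewrite ?inE/= ?in_itv/= ?andbT//.
  by rewrite -subr_ge0 QXY.
- have := HQ _ v01; rewrite /hazard_quantile.
  by rewrite lef_pV2 ?posrE ?mulr_gt0 ?subr_gt0// ler_pM2l ?subr_gt0.
Qed.
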